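(* Let $D\ge1$ and $n\ge1$ be integers and let $f:[0,1)^D\to\mathbb{R}$ be square integrable with variance $\sigma^2(f)>0$. Let $\mathcal{X}\in[0,1)^{n\times D}$ have rows $\boldsymbol{x}_1,\dots,\boldsymbol{x}_n$ and columns $\vec{\boldsymbol{x}}_1,\dots,\vec{\boldsymbol{x}}_D\in[0,1)^n$, and suppose that plain Monte Carlo sampling is used, i.e. all $nD$ entries of $\mathcal{X}$ are independent and uniformly distributed on $[0,1)$. Put $$F(\mathcal{X})=\frac1n\sum_{i=1}^n f(\boldsymbol{x}_i),$$ viewed as a function of the $D$ independent vector-valued inputs $\vec{\boldsymbol{x}}_1,\dots,\vec{\boldsymbol{x}}_D$. Then for every $u\subseteq\{1,\dots,D\}$ the ANOVA effect of $F$ for $u$ is $$F_u(\mathcal{X})=\frac1n\sum_{i=1}^n f_u(\boldsymbol{x}_i),$$ and consequently $\sigma_u^2(F)=\sigma_u^2(f)/n$, $\underline{S}_u(F)=\underline{S}_u(f)$ and $\overline{S}_u(F)=\overline{S}_u(f)$ for every $u\subseteq\{1,\dots,D\}$, and the vector-wise (column-wise) mean dimension of $F$ equals the mean dimension of $f$: $$\nu(F)=\nu(f).$$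
   Context: ANOVA decomposition. Let $g$ be a real-valued square integrable function of $D$ independent random inputs $X_1,\dots,X_D$ (the inputs may be real-valued or vector-valued), with mean $\mu$ and variance $\sigma^2(g)$. For $u\subseteq\{1,\dots,D\}$, let $|u|$ be its cardinality. The effects $g_u$ are defined recursively by $$g_\varnothing=\mu,\qquad g_u=\mathbb{E}\bigl(g\mid X_j,\ j\in u\bigr)-\sum_{v\subsetneq u}g_v,$$ so that $g=\sum_{u}g_u$ and $g_u$ depends only on $(X_j)_{j\in u}$. The variance components are $\sigma_u^2(g)=\mathrm{var}(g_u)$, and $\sigma^2(g)=\sum_u\sigma_u^2(g)$. The Sobol' indices are $$\underline{\tau}_u^2(g)=\sum_{v\subseteq u}\sigma_v^2(g),\qquad \overline{\tau}_u^2(g)=\sum_{v\cap u\ne\varnothing}\sigma_v^2(g),$$ with normalized versions $\underline{S}_u(g)=\underline{\tau}_u^2(g)/\sigma^2(g)$ and $\overline{S}_u(g)=\overline{\tau}_u^2(g)/\sigma^2(g)$. The mean dimension (in the superposition sense) is $$\nu(g)=\frac{\sum_u|u|\,\sigma_u^2(g)}{\sum_u\sigma_u^2(g)}=\frac1{\sigma^2(g)}\sum_{j=1}^D\overline{\tau}_{\{j\}}^2(g).$$ For $f:[0,1)^D\to\mathbb{R}$ these quantities are taken with $D$ independent real inputs uniform on $[0,1)$. For $F$ they are taken with the $D$ independent inputs being the columns $\vec{\boldsymbol{x}}_1,\dots,\vec{\boldsymbol{x}}_D$ of $\mathcal{X}$, each taking values in $[0,1)^n$; the resulting $\nu(F)$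 is called the vector-wise (or column-wise) mean dimension. *)

(* Defs.v *)
From HB Require Import structures.
From mathcomp Require Import all_boot all_order all_algebra.
From mathcomp Require Import all_classical all_reals all_analysis.

Set Implicit Arguments.
Unset Strict Implicit.
Unset Printing Implicit Defensive.

Import Order.TTheory GRing.Theory Num.Theory.
Import numFieldNormedType.Exports.

Local Open Scope classical_set_scope.
Local Open Scope ring_scope.

(* The half-open interval [0, 1), with the trace of the Borel sigma-algebra
   of R. *)
Definition unitI (R : realType) : Type := {x : R | (0 <= x) && (x < 1)}.

HB.instance Definition _ (R : realType) := Choice.on (unitI R).

Lemma unitI_point_subproof (R : realType) : (0 <= 0 :> R) && (0 < 1 :> R).
Proof. by rewrite lexx ltr01. Qed.

HB.instance Definition _ (R : realType) :=
  isPointed.Build (unitI R) (exist _ 0 (unitI_point_subproof R)).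

Definition unitI_val (R : realType) (x : unitI R) : R := sval x.

HB.instance Definition _ (R : realType) :=
  Measurable.copy (unitI R) (g_sigma_algebra_preimageType (@unitI_val R)).

Section random_elements.
Context d dT (Omega : measurableType d) (T : measurableType dT) (R : realType).
Variable P : probability Omega R.

Definition mutually_independent (I : finType) (X : I -> Omega -> T) : Prop :=
  forall (J : {set I}) (B : I -> set T),
    (forall i, i \in J -> measurable (B i)) ->
    P (\bigcap_(i in [set` J]) (X i @^-1` B i)) =
    (\prod_(i in J) P (X i @^-1` B i))%E.

(* [uniform_prob] is the uniform law on the closed interval [0, 1]; as the
   endpoint 1 is a null set, its trace is the uniform law on [0, 1). *)
Definition uniform_on_unitI (X : Omega -> unitI R) : Prop :=
  measurable_fun setT X /\
  forall B : set R, measurable B ->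
    P ((@unitI_val R \o X) @^-1` B) = uniform_prob (@ltr01 R) B.

(* [h] is a version of the conditional expectation of [g] given the
   sigma-algebra [G]. *)
Definition is_cond_expectation (G : set (set Omega)) (g h : Omega -> R) : Prop :=
  [/\ forall B : set R, measurable B -> G (h @^-1` B),
      P.-integrable setT (EFin \o h)
    & forall A, G A ->
        (\int[P]_(w in A) (h w)%:E = \int[P]_(w in A) (g w)%:E)%E].

(* A chosen version; two versions agree almost surely. *)
Definition cond_expectation (G : set (set Omega)) (g : Omega -> R) : Omega -> R :=
  xget (cst 0) [set h | is_cond_expectation G g h].

End random_elements.

Section anova.
Context d dT (Omega : measurableType d) (T : measurableType dT) (R : realType).
Variables (P : probability Omega R) (D : nat) (X : 'I_D -> Omega -> T).
Variable g : Omega -> R.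
Implicit Types u v : {set 'I_D}.

Definition sigma_inputs u : set (set Omega) :=
  <<s \bigcup_(j in [set` u]) preimage_set_system setT (X j) measurable >>.

Fixpoint effect_rec (k : nat) u : Omega -> R :=
  if u == finset.set0 then cst (fine 'E_P[g])
  else if k is k'.+1 then
    fun w => cond_expectation P (sigma_inputs u) g w
             - \sum_(v : {set 'I_D} | v \proper u) effect_rec k' v w
  else cst 0.

(* The bound [#|u|] on the depth of the recursion is never reached before the
   empty set, see [anova_effectE]. *)
Definition anova_effect u : Omega -> R := effect_rec #|u| u.

Lemma effect_rec_irr k l u :
  (#|u| <= k)%N -> (#|u| <= l)%N -> effect_rec k u = effect_rec l u.
Proof.
elim: k l u => [|k IHk] [|l] u //=; rewrite ?leqn0 ?cards_eq0.
- by move=> ->.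
- by move=> _ ->.
move=> uk ul; case: ifP => // _; apply: funext => w; congr (_ - _).
apply: eq_bigr => v /proper_card vu; congr (_ w).
by apply: IHk; rewrite -ltnS; apply: (leq_trans vu).
Qed.

Lemma anova_effectE u :
  anova_effect u =
  if u == finset.set0 then cst (fine 'E_P[g])
  else fun w => cond_expectation P (sigma_inputs u) g w
                - \sum_(v : {set 'I_D} | v \proper u) anova_effect v w.
Proof.
rewrite /anova_effect; case: ifP => [/eqP ->|u0]; first by rewrite cards0 /= eqxx.
have : (0 < #|u|)%N by rewrite card_gt0 u0.
case uk: #|u| => [|k] //= _; rewrite u0; apply: funext => w; congr (_ - _).
apply: eq_bigr => v /proper_card vu; congr (_ w).
by apply: effect_rec_irr => //; rewrite -ltnS -uk.
Qed.

Local Open Scope ereal_scope.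

Definition variance_component u : \bar R := 'V_P[anova_effect u].

Definition lower_sobol u : \bar R :=
  \sum_(v : {set 'I_D} | v \subset u) variance_component v.

Definition upper_sobol u : \bar R :=
  \sum_(v : {set 'I_D} | v :&: u != finset.set0) variance_component v.

Definition normalized_lower_sobol u : \bar R := lower_sobol u / 'V_P[g].

Definition normalized_upper_sobol u : \bar R := upper_sobol u / 'V_P[g].

Definition mean_dimension : \bar R :=
  (\sum_(u : {set 'I_D}) (#|u|%:R)%:E * variance_component u)
  / (\sum_(u : {set 'I_D}) variance_component u).

End anova.

Section sampling.
Context d (Omega : measurableType d) (R : realType) (T : Type).
Variables (n D : nat) (x : 'I_n -> 'I_D -> Omega -> T).

Definition row_point (i : 'I_n) (w : Omega) : D.-tuple T :=
  [tuple x i j w | j < D].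

Definition column_point (j : 'I_D) (w : Omega) : n.-tuple T :=
  [tuple x i j w | i < n].

Definition sample_mean (f : D.-tuple T -> R) (w : Omega) : R :=
  n%:R^-1 * \sum_(i < n) f (row_point i w).

End sampling.

Definition coordinate (T : Type) (D : nat) (j : 'I_D) (x : D.-tuple T) : T :=
  tnth x j.

(* Main.v *)
From HB Require Import structures.
Require Import Defs.
From mathcomp Require Import all_boot all_order all_algebra.
From mathcomp Require Import all_classical all_reals all_analysis.
From mathcomp Require Import measurable_realfun ring lra.

Set Implicit Arguments.
Unset Strict Implicit.
Unset Printing Implicit Defensive.

Import Order.TTheory GRing.Theory Num.Theory.
Import numFieldNormedType.Exports.

Local Open Scope classical_set_scope.
Local Open Scope ring_scope.

(** The ANOVA effects are built from conditional expectations by subtraction, so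
    everything rests on the conditional expectation of the sample mean F given
    the columns [x_j], j in u.  By linearity it is the mean over i of the
    conditional expectations of [f (x_i)], and those are
    [h (x_i)], where h is the conditional expectation of f given the
    coordinates in u: the rows other than i carry no information on
    [f (x_i)] (lemma [cond_expectation_row]).  To see this, test against the
    boxes generated by the entries of the columns in u.  Such a box is an event
    about the other rows intersected with the preimage under row i of a box in
    the coordinates in u.  The first factor is independent of row i, whose law
    is P0, so the integral over the box of [f (x_i)] is the probability of the
    first event times an integral of f over a set where f and h have the same
    integral (lemma [integral_indep_event]).  Boxes form a pi-system, and
    integrals that agree on a pi-system agree on the sigma-algebra it
    generates (lemma [integral_eq_pi_system]).

    Since versions of conditional expectations agree almost surely, induction
    on the cardinal of u gives
    [F_u = n^-1 * sum_i f_u (x_i)] almost surely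
    (lemma [anova_effect_sample_mean]).  The rows are independent, hence
    [f_u (x_i)] and [f_u (x_k)] are uncorrelated and the variance of F_u is that
    of f_u divided by n (lemma [variance_sample_mean]).  The same holds for F
    itself, so the factor [1 / n] cancels in every ratio of variances.

    Two facts on conditional expectations are needed on the way:
    they exist, by the Radon-Nikodym theorem on the sub-sigma-algebra, and
    they are square integrable when the conditioned function is, which makes
    the effects have a variance. *)

(** * Square integrable functions and their variances *)

Lemma Lfun2_of_sqr d (T : measurableType d) (R : realType)
    (mu : {measure set T -> \bar R}) (f : T -> R) :
  measurable_fun setT f -> (\int[mu]_w (f w ^+ 2)%:E < +oo)%E ->
  f \in Lfun mu 2%:E.
Proof.
move=> mf fi; rewrite inE; apply/andP; split; rewrite inE//=.
rewrite /finite_norm unlock /=.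
apply: poweR_lty.
under eq_integral do rewrite /= powR_mulrn// -normrX ger0_norm ?sqr_ge0//.
exact: fi.
Qed.

Section square_integrable.
Context d (Omega : measurableType d) (R : realType) (P : probability Omega R).

Lemma Lfun2_Lfun1 (g : Omega -> R) : g \in Lfun P 2%:E -> g \in Lfun P 1.
Proof. by apply: Lfun_subset12; exact: fin_num_measure. Qed.

Lemma Lfun2_integrable (g : Omega -> R) :
  g \in Lfun P 2%:E -> P.-integrable setT (EFin \o g).
Proof. by move=> /Lfun2_Lfun1/Lfun1_integrable. Qed.

Lemma Lfun2_measurable (g : Omega -> R) :
  g \in Lfun P 2%:E -> measurable_fun setT g.
Proof. by move=> /Lfun2_integrable/measurable_int/measurable_EFinP. Qed.

Lemma Lfun2_sum (I : Type) (s : seq I) (Q : pred I) (g : I -> Omega -> R) :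
  (forall i, Q i -> g i \in Lfun P 2%:E) ->
  (fun w => \sum_(i <- s | Q i) g i w) \in Lfun P 2%:E.
Proof.
move=> gL; rewrite (_ : (fun w => _) = \sum_(i <- s | Q i) g i).
  by apply: rpred_sum; rewrite ?lee1n.
by apply/funext => w; rewrite fct_sumE.
Qed.

Lemma expectation_ae_eq (X Y : Omega -> R) :
  measurable_fun setT X -> measurable_fun setT Y ->
  {ae P, forall w, X w = Y w} -> ('E_P[X] = 'E_P[Y])%E.
Proof.
move=> mX mY XY; rewrite unlock; apply: ae_eq_integral => //.
- exact/measurable_EFinP.
- exact/measurable_EFinP.
- by apply: filterS XY => w /= -> _.
Qed.

Lemma variance_ae_eq (X Y : Omega -> R) :
  X \in Lfun P 2%:E -> Y \in Lfun P 2%:E ->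
  {ae P, forall w, X w = Y w} -> 'V_P[X] = 'V_P[Y].
Proof.
move=> X2 Y2 XY.
have mX := Lfun2_measurable X2; have mY := Lfun2_measurable Y2.
rewrite !varianceE// (expectation_ae_eq mX mY XY); congr (_ - _)%E.
have sqrE (Z : Omega -> R) : Z ^+ 2 = (fun w => Z w ^+ 2).
  by apply/funext => w; rewrite !expr2.
rewrite !sqrE; apply: expectation_ae_eq.
- exact: measurable_funX.
- exact: measurable_funX.
- by apply: filterS XY => w ->.
Qed.

Lemma variance_sum_uncorrelated (I : eqType) (s : seq I) (X : I -> Omega -> R) :
  uniq s -> (forall i, X i \in Lfun P 2%:E) ->
  (forall i j, i != j -> covariance P (X i) (X j) = 0%E) ->
  'V_P[\sum_(i <- s) X i] = (\sum_(i <- s) 'V_P[X i])%E.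
Proof.
move=> + X2 X0; elim: s => [|i s IH] /=.
  by rewrite !big_nil => _; exact: variance_cst.
move=> /andP[si us]; rewrite !big_cons -IH//.
have sum2 (r : seq I) : \sum_(j <- r) X j \in Lfun P 2%:E.
  by apply: rpred_sum => //; rewrite lee1n.
rewrite [LHS](varianceD (X2 i) (sum2 s)).
suff -> : covariance P (X i) (\sum_(j <- s) X j) = 0%E by rewrite mule0 adde0.
elim: s si {IH us} => [|j s IH].
  by rewrite big_nil => _; exact: covariance_cst_r.
rewrite inE negb_or => /andP[ij si]; rewrite big_cons covarianceDr//.
by rewrite X0// IH// adde0.
Qed.

End square_integrable.

(** * Conditional expectation given a generated sigma-algebra *)

Section conditional_expectation.
Context d (Omega : measurableType d) (R : realType) (P : probability Omega R).
Variable C : set (set Omega).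
Hypothesis CM : C `<=` measurable.

(** The sub-sigma-algebra is turned into a measurable space of its own, on which
    P is pushed forward by the identity, so that the results on measures apply
    to it. *)
Let GT := g_sigma_algebraType C.
Let forget : Omega -> GT := id.

Lemma sub_sigma_measurable : <<s C >> `<=` @measurable _ Omega.
Proof. by apply: smallest_sub => //; exact: sigma_algebra_measurable. Qed.

Let mforget : measurable_fun [set: Omega] forget.
Proof. by move=> _ A mA; rewrite setTI; exact: sub_sigma_measurable. Qed.

Let forget_mfun : {mfun Omega >-> GT} :=
  HB.pack forget (isMeasurableFun.Build _ _ _ _ forget mforget).

Let PG : probability GT R := distribution P forget_mfun.

Let integralG (f : GT -> R) (A : set GT) : measurable_fun [set: GT] f ->
  P.-integrable setT (EFin \o (f : Omega -> R)) -> measurable A ->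
  (\int[PG]_(w in A) (f w)%:E = \int[P]_(w in A) (f w)%:E)%E.
Proof.
move=> mf fi mA; rewrite /PG /distribution.
rewrite (@integral_pushforward _ _ _ _ _ _ mforget P A (EFin \o f)) //.
  exact/measurable_EFinP.
exact: integrableS (sub_sigma_measurable mA) _ fi.
Qed.

Let is_cond_expectationP (g h : Omega -> R) :
  is_cond_expectation P <<s C >> g h <->
  [/\ measurable_fun [set: GT] (h : GT -> R), P.-integrable setT (EFin \o h) &
    forall A, <<s C >> A ->
      (\int[PG]_(w in A) (h w)%:E = \int[P]_(w in A) (g w)%:E)%E].
Proof.
split=> -[mh hi hg].
  have mh' : measurable_fun [set: GT] (h : GT -> R).
    by move=> _ B mB; rewrite setTI; exact: mh.
  by split=> // A sA; rewrite integralG//; exact: hg.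
split=> // [B mB|A sA].
  by have := mh measurableT B mB; rewrite setTI.
by rewrite -integralG//; exact: hg.
Qed.

Let induced_charge_restriction (g : Omega -> R) :
    P.-integrable setT (EFin \o g) ->
  exists nu : {charge set GT -> \bar R}, forall A,
    nu A = (\int[P]_(w in A) (g w)%:E)%E.
Proof.
move=> gi.
(* The charge structure on a pushforward depends on a proof that the map is
   measurable; [pose] abstracts over it and it is supplied afterwards. *)
pose nu := (pushforward (induced_charge gi) forget : {charge set GT -> \bar R}).
by exists (nu mforget).
Qed.

(** The conditional expectation is the Radon-Nikodym derivative, on the
    sub-sigma-algebra, of the charge with density g. *)
Lemma cond_expectation_exists (g : Omega -> R) :
  P.-integrable setT (EFin \o g) ->
  exists h, is_cond_expectation P <<s C >> g h.
Proof.
move=> gi.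
have [nu nuE] := induced_charge_restriction gi.
have nuP : nu `<< PG.
  apply/null_content_dominatesP => A mA PA.
  rewrite nuE; apply: null_set_integral => //; first exact: sub_sigma_measurable.
  by apply: measurable_funTS; exact: measurable_int gi.
pose f := Radon_Nikodym nu PG.
have ff x : f x \is a fin_num := Radon_Nikodym_fin_num x nuP.
have fE : EFin \o (fine \o f) = f by apply/funext => x /=; rewrite fineK.
have fi : PG.-integrable setT f := Radon_Nikodym_integrable nuP.
have mf : measurable_fun [set: GT] (fine \o f).
  by apply/measurable_EFinP; rewrite fE; exact: measurable_int fi.
exists (fine \o f); apply/is_cond_expectationP; split => //.
  rewrite fE; apply/integrableP; split.
    by apply: (measurableT_comp (measurable_int _ fi) mforget).
  have [mff] := integrableP _ _ _ fi.
  rewrite [X in (X < _)%E -> _](@ge0_integral_pushforward _ _ _ _ _ _ mforget)//.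
  exact: measurableT_comp.
move=> A mA; rewrite -nuE (Radon_Nikodym_integral nuP mA).
by apply: eq_integral => w _ /=; rewrite fineK.
Qed.

Lemma is_cond_expectation_ae_eq (g h h' : Omega -> R) :
  is_cond_expectation P <<s C >> g h -> is_cond_expectation P <<s C >> g h' ->
  {ae P, forall w, h w = h' w}.
Proof.
move=> /is_cond_expectationP[mh hi hg] /is_cond_expectationP[mh' h'i h'g].
have : ae_eq PG [set: GT] (EFin \o (h : GT -> R)) (EFin \o h').
  apply: integral_ae_eq => //.
  - apply: integrable_pushforward => //.
    exact/measurable_EFinP.
  - exact/measurable_EFinP.
  - by move=> E _ mE; rewrite hg// h'g.
move=> [N [mN PN hN]]; exists N; split => //.
- exact: sub_sigma_measurable.
- by move=> w hw; apply: hN => /= hh; apply: hw; exact: EFin_inj (hh I).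
Qed.

Lemma cond_expectation_spec (g : Omega -> R) :
  P.-integrable setT (EFin \o g) ->
  is_cond_expectation P <<s C >> g (cond_expectation P <<s C >> g).
Proof.
move=> /cond_expectation_exists[h hP]; rewrite /cond_expectation.
by apply: (@xgetPex _ (cst 0) (is_cond_expectation P <<s C >> g)); exists h.
Qed.

Lemma is_cond_expectation_measurable (g h : Omega -> R) :
  is_cond_expectation P <<s C >> g h -> measurable_fun setT h.
Proof.
by move=> [mh _ _] _ B mB; rewrite setTI; apply: sub_sigma_measurable; exact: mh.
Qed.

Lemma is_cond_expectation_mean (I : finType) (c : R) (g h : I -> Omega -> R) :
  (forall i, P.-integrable setT (EFin \o g i)) ->
  (forall i, is_cond_expectation P <<s C >> (g i) (h i)) ->
  is_cond_expectation P <<s C >>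
    (fun w => c * \sum_i g i w) (fun w => c * \sum_i h i w).
Proof.
move=> gi hP.
have hi i : P.-integrable setT (EFin \o h i) by case: (hP i).
have integral_mean (k : I -> Omega -> R) A : @measurable _ Omega A ->
    (forall i, P.-integrable setT (EFin \o k i)) ->
    (\int[P]_(w in A) (c * \sum_i k i w)%:E =
      c%:E * \sum_i \int[P]_(w in A) (k i w)%:E)%E.
  move=> mA ki.
  have kA i : P.-integrable A (EFin \o k i) by exact: integrableS (ki i).
  under eq_integral do rewrite EFinM -sumEFin.
  rewrite integralZl//; last by apply: integrable_sum => // i _; exact: kA.
  by rewrite integral_sum// => i _; exact: kA.
split.
- move=> B mB.
  suff : measurable_fun [set: GT] ((fun w => c * \sum_i h i w) : GT -> R).
    by move=> /(_ measurableT B mB); rewrite setTI.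
  apply: measurable_funM => //; apply: measurable_sum => i.
  by have /is_cond_expectationP[] := hP i.
- rewrite [X in _.-integrable _ X](_ : _ = fun w => (c%:E * \sum_i (h i w)%:E)%E).
    by apply: integrableZl => //; apply: integrable_sum => // i _; exact: hi.
  by apply/funext => w /=; rewrite EFinM -sumEFin.
- move=> A sA; have mA := sub_sigma_measurable sA.
  rewrite !integral_mean//; congr (_ * _)%E; apply: eq_bigr => i _.
  by case: (hP i) => _ _; exact.
Qed.

(** On A the distance from h to q is at most 1, so
    [h ^+ 2 <= 2 * q * h - q ^+ 2 + 1], whereas
    [2 * q * g - q ^+ 2 + 1 <= g ^+ 2 + 1] everywhere.  The two bounds are the
    same affine function of h and of g, and A belongs to the sub-sigma-algebra,
    so their integrals over A agree. *)
Let sqr_integral_slice (g h : Omega -> R) (q : R)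
    (A := [set w | q <= h w < q + 1]) :
  P.-integrable setT (EFin \o g) ->
  P.-integrable setT (EFin \o (fun w => g w ^+ 2)) ->
  is_cond_expectation P <<s C >> g h ->
  (\int[P]_(w in A) (h w ^+ 2)%:E <= \int[P]_(w in A) (g w ^+ 2 + 1)%:E)%E.
Proof.
move=> gi g2i hP; have mh := is_cond_expectation_measurable hP.
have [hG hi hg] := hP.
have GA : <<s C >> A.
  have -> : A = h @^-1` `[q, q + 1[ by apply/seteqP; split=> w /=; rewrite in_itv.
  by apply: hG; exact: measurable_itv.
have mA := sub_sigma_measurable GA.
have ci (c : R) : P.-integrable A (EFin \o cst c).
  by apply: finite_measure_integrable_cst.
have li (f : Omega -> R) : P.-integrable setT (EFin \o f) ->
    P.-integrable A (fun w => ((2 * q)%:E * (f w)%:E)%E).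
  by move=> fi; apply: integrableZl => //; exact: integrableS fi.
have bound : (\int[P]_(w in A) (h w ^+ 2)%:E <=
    \int[P]_(w in A) ((2 * q)%:E * (h w)%:E + (1 - q ^+ 2)%:E))%E.
  apply: ge0_le_integral => //.
  - by move=> w _; rewrite lee_fin sqr_ge0.
  - by apply/measurable_EFinP/measurable_funTS/measurable_funX.
  - by apply: measurable_int (integrableD _ (li _ hi) (ci (1 - q ^+ 2))).
  - move=> w /= /andP[h1 h2]; rewrite -EFinM -EFinD lee_fin.
    nra.
apply: (le_trans bound).
rewrite integralD//; [|exact: li|exact: (ci (1 - q ^+ 2))].
rewrite integralZl//; last exact: integrableS hi.
rewrite hg// -integralZl//; last exact: integrableS gi.
rewrite -integralD//; [|exact: li|exact: (ci (1 - q ^+ 2))].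
apply: le_integral => //.
- by apply: integrableD (ci (1 - q ^+ 2)) => //; exact: li.
- under [X in _.-integrable _ X]funext do rewrite EFinD.
  by apply: integrableD (ci 1) => //; exact: integrableS g2i.
- move=> w _; rewrite -EFinM -EFinD lee_fin.
  by have := sqr_ge0 (g w - q); nra.
Qed.

(** Cutting the range of h into the intervals between consecutive integers and
    summing the bounds on each of them, the integral of [h ^+ 2] is at most that
    of [g ^+ 2 + 1]. This weak form of the conditional Jensen inequality is
    enough for integrability. *)
Lemma cond_expectation_Lfun2 (g h : Omega -> R) :
  g \in Lfun P 2%:E -> is_cond_expectation P <<s C >> g h -> h \in Lfun P 2%:E.
Proof.
move=> g2 hP; have mh := is_cond_expectation_measurable hP.
have gi := Lfun2_integrable g2.
have g2i := Lfun2_integrable_sqr g2.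
(* Slices are indexed by natural numbers that encode the integer part of h. *)
pose F n : set Omega := [set w | pickle (Num.floor (h w)) = n].
have FE n : F n = set0 \/
    exists k : int, F n = [set w | k%:~R <= h w < k%:~R + 1].
  have [|] := pselect (F n !=set0); last by move=> /set0P/negP/negPn/eqP; left.
  move=> [w0 Fw0]; right; exists (Num.floor (h w0)); apply/seteqP; split=> w /=.
    by rewrite -Fw0 => /(pcan_inj pickleK) <-; rewrite -[1]/(1%:~R) -intrD floor_itv.
  rewrite -[1]/(1%:~R) -intrD -Fw0 => hw; congr pickle; exact: floor_def.
have mF n : measurable (F n).
  have [->//|[k ->]] := FE n.
  rewrite (_ : [set w | _] = h @^-1` `[k%:~R, k%:~R + 1[); last first.
    by apply/seteqP; split=> w /=; rewrite in_itv.
  by rewrite -[X in measurable X]setTI; apply: mh => //; exact: measurable_itv.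
have tF : trivIset setT F by move=> m n _ _ [w [/= <- <-]].
have UF : \bigcup_n F n = setT.
  by apply/seteqP; split=> w // _; exists (pickle (Num.floor (h w))).
have h2m : measurable_fun setT (EFin \o (fun w => h w ^+ 2)).
  by apply/measurable_EFinP; exact: measurable_funX.
apply: Lfun2_of_sqr => //.
have g21i : P.-integrable setT (EFin \o (fun w => g w ^+ 2 + 1)).
  under [X in _.-integrable _ X]funext do rewrite /= EFinD.
  by apply: integrableD => //; exact: (@finite_measure_integrable_cst _ _ _ P setT 1).
apply: le_lt_trans (integrable_lty measurableT g21i).
rewrite -{1 2}UF !ge0_integral_bigcup//; rewrite ?UF//.
- apply: lee_nneseries => [n _|n _].
    by move=> _; apply: integral_ge0 => w _; rewrite lee_fin sqr_ge0.
  have [->|[k ->]] := FE n; first by rewrite !integral_set0.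
  exact: sqr_integral_slice.
- exact: measurable_int g21i.
- by move=> w _; rewrite lee_fin addr_ge0// sqr_ge0.
- by move=> w _; rewrite lee_fin sqr_ge0.
Qed.

(** The sets on which the integrals of f and g agree form a Dynkin system: for
    complements subtract from the integral over the whole space, for disjoint
    unions use countable additivity. *)
Lemma integral_eq_pi_system (f g : Omega -> R) :
  setI_closed C ->
  P.-integrable setT (EFin \o f) -> P.-integrable setT (EFin \o g) ->
  (\int[P]_w (f w)%:E = \int[P]_w (g w)%:E)%E ->
  (forall A, C A -> (\int[P]_(w in A) (f w)%:E = \int[P]_(w in A) (g w)%:E)%E) ->
  forall A, <<s C >> A ->
    (\int[P]_(w in A) (f w)%:E = \int[P]_(w in A) (g w)%:E)%E.
Proof.
move=> CI fi gi fgT fgC.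
have compl (f' : Omega -> R) A : P.-integrable setT (EFin \o f') ->
    measurable A -> (\int[P]_(w in ~` A) (f' w)%:E =
      \int[P]_w (f' w)%:E - \int[P]_(w in A) (f' w)%:E)%E.
  move=> f'i mA.
  have f'A : (\int[P]_(w in A) (f' w)%:E)%E \is a fin_num.
    by apply: integrable_fin_num => //; exact: integrableS f'i.
  have -> : (\int[P]_w (f' w)%:E =
      \int[P]_(w in A) (f' w)%:E + \int[P]_(w in ~` A) (f' w)%:E)%E.
    rewrite -integral_setU ?setUv//; first exact: measurableC.
      exact: measurable_int f'i.
    by apply/disj_setPS; rewrite setICr.
  by rewrite addeAC subee// add0e.
apply: (@dynkin_induction _ GT C) => //.
- move=> A mA fgA; rewrite !compl//; first by rewrite fgT fgA.
  + exact: sub_sigma_measurable.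
  + exact: sub_sigma_measurable.
- move=> F mF tF fgF.
  have mF' k : @measurable _ Omega (F k) := sub_sigma_measurable (mF k).
  rewrite !integral_bigcup//; first by apply: eq_eseriesr => k _; exact: fgF.
    by apply: integrableS gi => //; exact: bigcupT_measurable.
  by apply: integrableS fi => //; exact: bigcup_measurable.
Qed.

End conditional_expectation.

(** * Square integrability of the effects *)

Section effects.
Context d dT (Omega : measurableType d) (T : measurableType dT) (R : realType).
Variables (P : probability Omega R) (D : nat) (X : 'I_D -> Omega -> T).
Hypothesis mX : forall j, measurable_fun setT (X j).

Lemma input_preimages_measurable (u : {set 'I_D}) :
  \bigcup_(j in [set` u]) preimage_set_system setT (X j) measurable
    `<=` measurable.
Proof. by move=> _ [j _ [B mB <-]]; exact: mX. Qed.

Lemma anova_effect_Lfun2 (g : Omega -> R) (u : {set 'I_D}) :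
  g \in Lfun P 2%:E -> anova_effect P X g u \in Lfun P 2%:E.
Proof.
move=> g2; move: {2}_.+1 (ltnSn #|u|) => k.
elim: k u => // k IH u uk; rewrite anova_effectE.
case: ifPn => [_|u0]; first exact: Lfun_cst.
rewrite (_ : (fun w => _) = cond_expectation P (sigma_inputs X u) g
    - fun w => \sum_(v : {set 'I_D} | v \proper u) anova_effect P X g v w)//.
apply: rpredB; first by rewrite lee1n.
  have mG := @input_preimages_measurable u.
  move=> ?; apply: (cond_expectation_Lfun2 mG g2); apply: cond_expectation_spec => //.
  exact: Lfun2_integrable.
move=> ?; apply: Lfun2_sum => v /proper_card vu.
by apply: IH; exact: leq_trans vu _.
Qed.

End effects.

(** * Boxes generate the product sigma-algebra *)

Section product_law.
Context dT (T : measurableType dT) (R : realType) (D : nat).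

Definition tuple_box (B : 'I_D -> set T) : set (D.-tuple T) :=
  [set t | forall j, B j (tnth t j)].

Definition tuple_boxes : set (set (D.-tuple T)) :=
  [set tuple_box B | B in [set B | forall j, measurable (B j)]].

Lemma tuple_boxE B :
  tuple_box B = \bigcap_(j in [set: 'I_D]) (@coordinate T D j @^-1` B j).
Proof. by apply/seteqP; split => t /= h j; [move=> _; exact: h|exact: h]. Qed.

Lemma measurable_coordinate (j : 'I_D) :
  measurable_fun setT (@coordinate T D j).
Proof. exact: measurable_tnth. Qed.

Lemma measurable_tuple_box B :
  (forall j, measurable (B j)) -> measurable (tuple_box B).
Proof.
move=> mB; rewrite tuple_boxE; apply: fin_bigcap_measurable => // j _.
by rewrite -[X in measurable X]setTI; exact: measurable_coordinate.
Qed.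

Lemma setI_closed_tuple_boxes : setI_closed tuple_boxes.
Proof.
move=> _ _ [B mB <-] [B' mB' <-]; exists (fun j => B j `&` B' j) => [j|].
  exact: measurableI.
apply/seteqP; split=> t /=; first by move=> h; split=> j; case: (h j).
by move=> [h h'] j; split.
Qed.

Lemma tuple_boxT : tuple_box (fun=> setT) = setT.
Proof. by apply/seteqP; split. Qed.

Lemma measurable_tupleE : @measurable _ (D.-tuple T) = <<s tuple_boxes >>.
Proof.
apply/seteqP; split; last first.
  apply: smallest_sub; first exact: sigma_algebra_measurable.
  by move=> _ [B mB <-]; exact: measurable_tuple_box.
have : measurable_fun [set: g_sigma_algebraType tuple_boxes] (id : _ -> D.-tuple T).
  apply/measurable_fun_tnthP => j _ B mB; rewrite setTI.
  apply: sub_sigma_algebra.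
  exists (fun k => if k == j then B else setT) => [k|].
    by case: ifP.
  apply/seteqP; split=> t /=; first by move/(_ j); rewrite eqxx.
  by move=> tB k; case: eqP => // ->.
by move=> mid A mA; have := mid measurableT A mA; rewrite setTI.
Qed.

End product_law.

(** * Integration over an event independent of a random vector *)

Section independent_event.
Context dT (T : measurableType dT) (R : realType) (D : nat).
Context d (Omega : measurableType d) (P : probability Omega R).
Variables (P0 : probability (D.-tuple T) R) (A : set Omega).
Variable Y : Omega -> D.-tuple T.
Hypotheses (mA : measurable A) (mY : measurable_fun setT Y).
Hypothesis AY : forall B : 'I_D -> set T, (forall j, measurable (B j)) ->
  P (A `&` Y @^-1` tuple_box B) = (P A * P0 (tuple_box B))%E.

Let pA : {nonneg R} := NngNum (fine_ge0 (measure_ge0 P A)).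

Let pAE : (pA%:num)%:E = P A.
Proof. by rewrite /= fineK// fin_num_measure. Qed.

(** Both sides are finite measures in S that agree on boxes: the law of Y under
    the restriction of P to A, and P0 rescaled by [P A]. *)
Lemma event_indep_tuple (S : set (D.-tuple T)) : measurable S ->
  P (A `&` Y @^-1` S) = (P A * P0 S)%E.
Proof.
move=> mS.
pose m1 := (pushforward (mrestr P mA) Y : {measure set (D.-tuple T) -> \bar R}).
have -> : P (A `&` Y @^-1` S) = m1 mY S by rewrite setIC.
rewrite -pAE -[RHS]/(mscale pA P0 S).
apply: (measure_unique (@tuple_boxes _ T D) (fun=> setT)) => //.
- exact: measurable_tupleE.
- exact: setI_closed_tuple_boxes.
- by move=> _; exists (fun=> setT) => //; rewrite tuple_boxT.
- by apply/seteqP; split => // t _; exists 0%N.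
- move=> _ [B mB <-]; rewrite /m1 /pushforward /mrestr /= /mscale pAE -AY//.
  by rewrite setIC.
- move=> _; rewrite [X in (X < _)%E](_ : _ = P A); last by rewrite -[in RHS](setTI A).
  by rewrite (le_lt_trans (probability_le1 P mA))// ltry.
Qed.

(** The law of Y under the restriction of P to A is P0 rescaled by [P A], so
    this is the change of variables formula. *)
Lemma ge0_integral_indep_event (f : D.-tuple T -> \bar R) S : measurable S ->
  measurable_fun setT f -> (forall t, 0 <= f t)%E ->
  (\int[P]_(w in A `&` Y @^-1` S) f (Y w) = P A * \int[P0]_(t in S) f t)%E.
Proof.
move=> mS mf f0.
have mYS (S' : set (D.-tuple T)) : measurable S' -> measurable (Y @^-1` S').
  by move=> mS'; rewrite -[X in measurable X]setTI; exact: mY.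
transitivity (\int[mrestr P mA]_(w in A `&` Y @^-1` S) f (Y w))%E.
  by apply: eq_measure_integral => B mB BA; rewrite /= /mrestr setIidl// => w /BA[].
transitivity (\int[mrestr P mA]_(w in Y @^-1` S) f (Y w))%E.
  rewrite [RHS](@ge0_negligible_integral _ _ _ _ _ (~` A))//.
  - by rewrite setDE setCK setIC.
  - exact: measurableC.
  - exact: mYS.
  - by apply: measurable_funTS; exact: measurableT_comp.
  - by rewrite /= /mrestr setICl measure0.
rewrite -(ge0_integral_pushforward mY) //; last exact: measurable_funTS.
rewrite -pAE -ge0_integral_mscale//; last exact: measurable_funTS.
apply: eq_measure_integral => B mB _.
by rewrite /= /pushforward /mrestr /mscale pAE setIC; exact: event_indep_tuple.
Qed.

Lemma integral_indep_event (f : D.-tuple T -> R) S : measurable S ->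
  P0.-integrable setT (EFin \o f) ->
  (\int[P]_(w in A `&` Y @^-1` S) (f (Y w))%:E =
   P A * \int[P0]_(t in S) (f t)%:E)%E.
Proof.
move=> mS fi; have mf := measurable_int _ fi.
have fSi : P0.-integrable S (EFin \o f) by exact: integrableS fi.
rewrite integralE.
rewrite [in RHS]integralE muleBr; last 2 first.
- by rewrite fin_num_measure.
- by rewrite fin_num_adde_defl// fin_numN integrable_neg_fin_num.
rewrite -!ge0_integral_indep_event//; last 2 first.
- exact: measurable_funeneg.
- exact: measurable_funepos.
by congr (_ - _)%E; apply: eq_integral => w _; rewrite ?funeposE ?funenegE.
Qed.

End independent_event.

(** * Independent rows *)

Section independent_rows.
Context dT (T : measurableType dT) (R : realType) (D n : nat).
Variable P0 : probability (D.-tuple T) R.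
Hypothesis indep0 : mutually_independent P0 (@coordinate T D).
Context d (Omega : measurableType d) (P : probability Omega R).
Variable x : 'I_n -> 'I_D -> Omega -> T.
Hypothesis mx : forall i j, measurable_fun setT (x i j).
Hypothesis indep : mutually_independent P (fun ij : 'I_n * 'I_D => x ij.1 ij.2).
Hypothesis law : forall i j B, measurable B ->
  P (x i j @^-1` B) = P0 (@coordinate T D j @^-1` B).

Let mxB i j B : measurable B -> measurable (x i j @^-1` B).
Proof. by move=> mB; rewrite -[X in measurable X]setTI; exact: mx. Qed.

Lemma measurable_row_point i : measurable_fun setT (row_point x i).
Proof.
apply/measurable_fun_tnthP => j; rewrite (_ : _ \o _ = x i j)//.
by apply/funext => w /=; rewrite tnth_mktuple.
Qed.

Lemma measurable_column_point j : measurable_fun setT (column_point x j).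
Proof.
apply/measurable_fun_tnthP => i; rewrite (_ : _ \o _ = x i j)//.
by apply/funext => w /=; rewrite tnth_mktuple.
Qed.

Let prob_tuple_box (B : 'I_D -> set T) : (forall j, measurable (B j)) ->
  P0 (tuple_box B) = (\prod_(j < D) P0 (@coordinate T D j @^-1` B j))%E.
Proof.
move=> mB; have := @indep0 [set: 'I_D]%SET B (fun j _ => mB j).
rewrite (_ : \bigcap_(i in _) _ = tuple_box B); last first.
  by rewrite tuple_boxE; apply/seteqP; split=> t h j _; apply: h => //=; rewrite inE.
by move=> ->; apply: eq_bigl => j; rewrite inE.
Qed.

Definition matrix_box (B : 'I_n -> 'I_D -> set T) : set Omega :=
  [set w | forall i j, B i j (x i j w)].

Let matrix_boxE B :
  matrix_box B =
  \bigcap_(ij in [set: 'I_n * 'I_D]) (x ij.1 ij.2 @^-1` B ij.1 ij.2).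
Proof. by apply/seteqP; split=> w /= h => [ij _|i j]; [exact: h|exact: (h (i, j))]. Qed.

Lemma measurable_matrix_box B :
  (forall i j, measurable (B i j)) -> measurable (matrix_box B).
Proof.
move=> mB; rewrite matrix_boxE; apply: fin_bigcap_measurable => // ij _.
exact: mxB.
Qed.

Lemma prob_matrix_box B : (forall i j, measurable (B i j)) ->
  P (matrix_box B) = (\prod_(i < n) P0 (tuple_box (B i)))%E.
Proof.
move=> mB.
have := @indep [set: 'I_n * 'I_D]%SET (fun ij => B ij.1 ij.2) (fun ij _ => mB ij.1 ij.2).
rewrite (_ : \bigcap_(i in _) _ = matrix_box B); last first.
  by rewrite matrix_boxE; apply/seteqP; split=> t h j _; apply: h => //=; rewrite inE.
move=> ->.
transitivity (\prod_(i < n) \prod_(j < D) P (x i j @^-1` B i j))%E.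
  by rewrite pair_bigA /=; apply: eq_bigl => j; rewrite inE.
apply: eq_bigr => i _; rewrite prob_tuple_box//.
by apply: eq_bigr => j _; rewrite law.
Qed.

(** The intersection is again a matrix box, with the i-th row of B replaced by
    that of the test box; in the product formula only the i-th factor, which was
    1, changes. *)
Lemma matrix_box_indep_row (B : 'I_n -> 'I_D -> set T) i S :
  (forall k j, measurable (B k j)) -> B i = (fun=> setT) -> measurable S ->
  P (matrix_box B `&` row_point x i @^-1` S) = (P (matrix_box B) * P0 S)%E.
Proof.
move=> mB Bi; apply: event_indep_tuple; first exact: measurable_matrix_box.
  exact: measurable_row_point.
move=> B' mB'.
have -> : matrix_box B `&` row_point x i @^-1` tuple_box B' =
    matrix_box (fun k => if k == i then B' else B k).
  apply/seteqP; split=> w /=.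
    move=> [Bw B'w] k j; case: eqP => [->|_]; last exact: Bw.
    by have := B'w j; rewrite tnth_mktuple.
  move=> h; split=> [k j|j].
    by have := h k j; case: eqP => // ->; rewrite Bi.
  by have := h i j; rewrite eqxx tnth_mktuple.
rewrite !prob_matrix_box//; last by move=> k j; case: eqP.
rewrite (bigD1 i)//= eqxx (bigD1 i (F := fun k => P0 (tuple_box (B k))))//= Bi.
rewrite tuple_boxT probability_setT mul1e muleC; congr (_ * _)%E.
by apply: eq_bigr => k /negbTE ->.
Qed.

Lemma law_row_point i S : measurable S -> P (row_point x i @^-1` S) = P0 S.
Proof.
move=> mS; have := @matrix_box_indep_row (fun _ _ => setT) i S.
have -> : matrix_box (fun _ _ => setT) = setT by apply/seteqP; split.
by rewrite setTI probability_setT mul1e; exact.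
Qed.

(** Two passes of [event_indep_tuple]: first from boxes to S for row i, with a
    box in row k as the fixed event, then from boxes to S' for row k, with the
    event that row i lies in S. *)
Lemma rows_indep i k S S' : i != k -> measurable S -> measurable S' ->
  P (row_point x i @^-1` S `&` row_point x k @^-1` S') = (P0 S * P0 S')%E.
Proof.
move=> ik mS mS'.
have mrS : measurable (row_point x i @^-1` S).
  by rewrite -[X in measurable X]setTI; exact: measurable_row_point.
rewrite -(law_row_point i mS); apply: event_indep_tuple => //.
  exact: measurable_row_point.
move=> B mB; pose B' l := if l == k then B else fun=> setT.
have mB' l j : measurable (B' l j) by rewrite /B'; case: eqP.
have <- : matrix_box B' = row_point x k @^-1` tuple_box B.
  apply/seteqP; split=> w /= h.
    by move=> j; have := h k j; rewrite /B' eqxx tnth_mktuple.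
  move=> l j; rewrite /B'; case: eqP => // ->.
  by have := h j; rewrite tnth_mktuple.
rewrite setIC matrix_box_indep_row ?law_row_point//; last first.
  by rewrite /B' (negbTE ik).
rewrite muleC prob_matrix_box//; congr (_ * _)%E.
rewrite (bigD1 k)//= {1}/B' eqxx big1 ?mule1// => l /negbTE lk.
by rewrite /B' lk tuple_boxT probability_setT.
Qed.

Lemma ge0_integral_row i (f : D.-tuple T -> \bar R) :
  measurable_fun setT f -> (forall t, 0 <= f t)%E ->
  (\int[P]_w f (row_point x i w) = \int[P0]_t f t)%E.
Proof.
move=> mf f0; rewrite -[RHS]mul1e -(@probability_setT _ _ _ P).
rewrite -(@ge0_integral_indep_event _ _ _ _ _ _ _ P0 setT (row_point x i))//.
- by rewrite preimage_setT setTI.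
- exact: measurable_row_point.
- move=> B mB; rewrite setTI probability_setT mul1e law_row_point//.
  exact: measurable_tuple_box.
Qed.

Lemma integrable_row i (f : D.-tuple T -> R) :
  P0.-integrable setT (EFin \o f) ->
  P.-integrable setT (EFin \o (f \o row_point x i)).
Proof.
move=> fi; have mf := measurable_int _ fi.
apply/integrableP; split.
  by apply: (measurableT_comp mf); exact: measurable_row_point.
have [_] := integrableP _ _ _ fi.
rewrite -(ge0_integral_row i (f := fun t => `|(f t)%:E|%E))//.
exact: measurableT_comp.
Qed.

Lemma integral_row i (f : D.-tuple T -> R) :
  P0.-integrable setT (EFin \o f) ->
  (\int[P]_w (f (row_point x i w))%:E = \int[P0]_t (f t)%:E)%E.
Proof.
move=> fi; rewrite -[RHS]mul1e -(@probability_setT _ _ _ P).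
rewrite -(@integral_indep_event _ _ _ _ _ _ _ P0 setT (row_point x i))//.
- by rewrite preimage_setT setTI.
- exact: measurable_row_point.
- move=> B mB; rewrite setTI probability_setT mul1e law_row_point//.
  exact: measurable_tuple_box.
Qed.

Section given_columns.
Variable u : {set 'I_D}.

(** Only the entries of the columns in u are constrained; these boxes are the
    pi-system used to test conditional expectations given those columns. *)
Definition column_boxes : set (set Omega) :=
  [set matrix_box B | B in [set B | (forall i j, measurable (B i j)) /\
    forall i j, j \notin u -> B i j = setT]].

Lemma setI_closed_column_boxes : setI_closed column_boxes.
Proof.
move=> _ _ [B [mB Bu] <-] [B' [mB' B'u] <-].
exists (fun i j => B i j `&` B' i j).
  split=> i j; first exact: measurableI.
  by move=> ju; rewrite Bu// B'u// setTI.
apply/seteqP; split=> t /=; first by move=> h; split=> i j; case: (h i j).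
by move=> [h h'] i j; split.
Qed.

Lemma column_boxes_measurable : column_boxes `<=` measurable.
Proof. by move=> _ [B [mB _] <-]; exact: measurable_matrix_box. Qed.

Lemma sigma_columns_sub :
  sigma_inputs (column_point x) u `<=` <<s column_boxes >>.
Proof.
apply: smallest_sub; first exact: smallest_sigma_algebra.
move=> _ [j ju [B mB <-]].
have : measurable_fun [set: g_sigma_algebraType column_boxes]
    (column_point x j : g_sigma_algebraType column_boxes -> n.-tuple T).
  apply/measurable_fun_tnthP => i _ B' mB'; rewrite setTI.
  apply: sub_sigma_algebra.
  exists (fun k l => if (k == i) && (l == j) then B' else setT).
    split=> k l; first by case: ifP.
    by case: andP => // -[_ /eqP ->] /negP; case; exact: ju.
  apply/seteqP; split=> w /=.
    by move/(_ i j); rewrite !eqxx tnth_mktuple.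
  by rewrite tnth_mktuple => wB k l; case: andP => // -[/eqP -> /eqP ->].
by move=> /(_ measurableT B mB).
Qed.

Lemma sigma_coordinates_row i S : sigma_inputs (@coordinate T D) u S ->
  sigma_inputs (column_point x) u (row_point x i @^-1` S).
Proof.
rewrite -[row_point x i @^-1` S]setTI; move: S.
apply: (@smallest_sub _ (sigma_algebra setT) _
  (image_set_system setT (row_point x i) (sigma_inputs (column_point x) u))).
  by apply: sigma_algebra_image; exact: smallest_sigma_algebra.
move=> _ [j ju [B mB <-]]; apply: sub_sigma_algebra; exists j => //.
exists ((@tnth n T)^~ i @^-1` B).
  by rewrite -[X in measurable X]setTI; exact: measurable_tnth.
by rewrite !setTI; apply/seteqP; split=> w /=; rewrite /coordinate !tnth_mktuple.
Qed.

Lemma sigma_coordinates_tuple_box (B : 'I_D -> set T) :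
  (forall j, measurable (B j)) -> (forall j, j \notin u -> B j = setT) ->
  sigma_inputs (@coordinate T D) u (tuple_box B).
Proof.
move=> mB Bu; rewrite tuple_boxE.
apply: (@fin_bigcap_measurable _ (g_sigma_algebraType _)) => // j _.
have [ju|/Bu ->] := boolP (j \in u); last first.
  by rewrite preimage_setT; exact: measurableT.
by apply: sub_sigma_algebra; exists j => //; exists (B j); rewrite ?setTI.
Qed.

(** A box on the columns in u splits into an event about the rows other than i
    and the condition that row i lies in a box on the coordinates in u. The
    former is independent of row i, hence factors out of both integrals, and on
    the latter f and h have the same integral by definition of h. *)
Lemma cond_expectation_row i (f h : D.-tuple T -> R) :
  P0.-integrable setT (EFin \o f) ->
  is_cond_expectation P0 (sigma_inputs (@coordinate T D) u) f h ->
  is_cond_expectation P (sigma_inputs (column_point x) u)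
    (f \o row_point x i) (h \o row_point x i).
Proof.
move=> fi [mh hi hf]; split.
- by move=> B mB; exact: (sigma_coordinates_row i (mh B mB)).
- exact: integrable_row.
move=> A /sigma_columns_sub.
apply: integral_eq_pi_system.
- exact: column_boxes_measurable.
- exact: setI_closed_column_boxes.
- exact: integrable_row.
- exact: integrable_row.
- rewrite !integral_row//; apply: hf.
  exact: (@measurableT _ (g_sigma_algebraType _)).
move=> _ [B [mB Bu] <-].
(* B0 leaves row i free. *)
pose B0 k := if k == i then fun=> setT else B k.
have mB0 k j : measurable (B0 k j) by rewrite /B0; case: eqP.
have -> : matrix_box B = matrix_box B0 `&` row_point x i @^-1` tuple_box (B i).
  apply/seteqP; split=> w /=.
    move=> Bw; split=> [k j|j]; last by rewrite tnth_mktuple; exact: Bw.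
    by rewrite /B0; case: eqP.
  move=> [B0w Bw] k j; have := B0w k j; rewrite /B0; case: eqP => // -> _.
  by have := Bw j; rewrite tnth_mktuple.
have indep_row B' : (forall j, measurable (B' j)) ->
    P (matrix_box B0 `&` row_point x i @^-1` tuple_box B') =
    (P (matrix_box B0) * P0 (tuple_box B'))%E.
  move=> mB'; apply: matrix_box_indep_row => //; first by rewrite /B0 eqxx.
  exact: measurable_tuple_box.
rewrite !(integral_indep_event (measurable_matrix_box mB0) (measurable_row_point i) indep_row)//;
  try exact: measurable_tuple_box.
congr (_ * _)%E; apply: hf.
by apply: sigma_coordinates_tuple_box => // j; exact: Bu.
Qed.

End given_columns.

Lemma Lfun2_row i (f : D.-tuple T -> R) :
  f \in Lfun P0 2%:E -> f \o row_point x i \in Lfun P 2%:E.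
Proof.
move=> f2; have mf := Lfun2_measurable f2.
apply: Lfun2_of_sqr; first exact: measurableT_comp (measurable_row_point i).
rewrite (ge0_integral_row i (f := fun t => (f t ^+ 2)%:E)).
- exact: integrable_lty (Lfun2_integrable_sqr f2).
- by apply/measurable_EFinP; exact: measurable_funX.
- by move=> t; rewrite lee_fin sqr_ge0.
Qed.

Lemma expectation_row i (f : D.-tuple T -> R) :
  f \in Lfun P0 1 -> ('E_P[f \o row_point x i] = 'E_P0[f])%E.
Proof. by move=> /Lfun1_integrable fi; rewrite unlock; exact: integral_row. Qed.

Lemma variance_row i (f : D.-tuple T -> R) :
  f \in Lfun P0 2%:E -> 'V_P[f \o row_point x i] = 'V_P0[f].
Proof.
move=> f2; rewrite /variance unlock expectation_row ?Lfun2_Lfun1//.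
rewrite unlock; set c := fine _.
rewrite -(ge0_integral_row i (f := fun t => ((f t - c) * (f t - c))%:E))//.
- apply/measurable_EFinP; have mfc : measurable_fun setT (fun t => f t - c).
    by apply: measurable_funB => //; exact: Lfun2_measurable f2.
  exact: measurable_funM.
- by move=> t; rewrite lee_fin -expr2 sqr_ge0.
Qed.

(** The joint law of two distinct rows is the product of P0 with itself; the
    right-hand side is the iterated integral given by Fubini's theorem. *)
Lemma integral_two_rows i k (f : D.-tuple T * D.-tuple T -> R) : i != k ->
  measurable_fun setT f ->
  P.-integrable setT (fun w => (f (row_point x i w, row_point x k w))%:E) ->
  (\int[P]_w (f (row_point x i w, row_point x k w))%:E =
   \int[P0]_s \int[P0]_t (f (s, t))%:E)%E.
Proof.
move=> ik mf fi.
pose Z w := (row_point x i w, row_point x k w).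
have mZ : measurable_fun setT Z.
  by apply: measurable_fun_pair; exact: measurable_row_point.
pose m' := (pushforward P Z : {measure set (D.-tuple T * D.-tuple T) -> \bar R}).
have lawZ S : measurable S -> (P0 \x P0)%E S = m' mZ S.
  apply: product_measure_unique => S1 S2 mS1 mS2.
  exact: rows_indep.
have mfE : measurable_fun setT (EFin \o f) by exact/measurable_EFinP.
have fi' : (m' mZ).-integrable setT (EFin \o f) by exact: integrable_pushforward.
have -> : (\int[P]_w (f (row_point x i w, row_point x k w))%:E =
    \int[m' mZ]_z (f z)%:E)%E.
  by rewrite [RHS](integral_pushforward mZ mfE).
rewrite (eq_measure_integral (P0 \x P0)%E); last by move=> S mS _; exact/esym/lawZ.
have fi2 : (P0 \x P0)%E.-integrable setT (EFin \o f).
  apply/integrableP; split => //.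
  rewrite (eq_measure_integral (m' mZ)); last by move=> S mS _; exact: lawZ.
  by have [] := integrableP _ _ _ fi'.
by rewrite -(integral12_prod_meas1 fi2).
Qed.

Lemma covariance_rows i k (f : D.-tuple T -> R) : i != k ->
  f \in Lfun P0 2%:E ->
  covariance P (f \o row_point x i) (f \o row_point x k) = 0%E.
Proof.
move=> ik f2; have f1 := Lfun2_Lfun1 f2.
have mf := Lfun2_measurable f2.
have ff1 := Lfun2_mul_Lfun1 (Lfun2_row i f2) (Lfun2_row k f2).
rewrite covarianceE//; [|exact/Lfun2_Lfun1/Lfun2_row..].
rewrite !expectation_row//.
have -> : ('E_P[(f \o row_point x i) * (f \o row_point x k)] = 'E_P0[f] * 'E_P0[f])%E.
  rewrite [in LHS]unlock.
  rewrite (@integral_two_rows i k (fun z => f z.1 * f z.2))//; last 2 first.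
  - by apply: measurable_funM; exact: measurableT_comp.
  - exact/Lfun1_integrable.
  have fi := Lfun2_integrable f2.
  have Ef : 'E_P0[f]%E \is a fin_num by exact: expectation_fin_num.
  rewrite -(fineK Ef); set e := fine _.
  have eE : (\int[P0]_t (f t)%:E)%E = e%:E by rewrite /e fineK// unlock.
  have inner s : (\int[P0]_t (f s * f t)%:E = (f s)%:E * e%:E)%E.
    by under eq_integral do rewrite EFinM; rewrite integralZl// eE.
  under eq_integral do rewrite inner.
  by rewrite integralZr// eE.
by rewrite subee// fin_numM// expectation_fin_num.
Qed.

Lemma sample_mean_Lfun2 (f : D.-tuple T -> R) :
  f \in Lfun P0 2%:E -> sample_mean x f \in Lfun P 2%:E.
Proof.
move=> f2.
rewrite (_ : sample_mean x f = n%:R^-1 \o* (fun w => \sum_(i < n) f (row_point x i w))).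
  apply: Lfun_scale; first by rewrite ler1n.
  by apply: Lfun2_sum => i _; exact: Lfun2_row.
by apply/funext => w; rewrite /= mulrC.
Qed.

(** * Sample means and their effects *)

Hypothesis n0 : (0 < n)%N.

Lemma variance_sample_mean (f : D.-tuple T -> R) : f \in Lfun P0 2%:E ->
  'V_P[sample_mean x f] = ('V_P0[f] / n%:R%:E)%E.
Proof.
move=> f2.
have f2' i : f \o row_point x i \in Lfun P 2%:E by exact: Lfun2_row.
rewrite (_ : sample_mean x f = n%:R^-1 \o* \sum_(i < n) (f \o row_point x i)); last first.
  by apply/funext => w; rewrite /= mulrC fct_sumE.
rewrite varianceZ; last by apply: rpred_sum => //; rewrite lee1n.
rewrite variance_sum_uncorrelated ?index_enum_uniq//; last first.
  by move=> i j ij; exact: covariance_rows.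
under eq_bigr do rewrite variance_row//.
rewrite -(fineK (variance_fin_num f2)) sumEFin -EFinM.
have nN0 : n%:R != 0 :> R by rewrite pnatr_eq0 -lt0n.
rewrite inver (negbTE nN0) -EFinM; congr (_%:E).
by rewrite sumr_const card_ord -mulr_natr; field.
Qed.

Lemma expectation_sample_mean (f : D.-tuple T -> R) :
  f \in Lfun P0 2%:E -> ('E_P[sample_mean x f] = 'E_P0[f])%E.
Proof.
move=> f2; have f1 := Lfun2_Lfun1 f2.
have nN0 : n%:R != 0 :> R by rewrite pnatr_eq0 -lt0n.
rewrite [in LHS]unlock.
under eq_integral do rewrite /sample_mean EFinM -sumEFin.
have fi i : P.-integrable setT (EFin \o (f \o row_point x i)).
  by apply: integrable_row; exact: Lfun2_integrable.
rewrite integralZl//; last by apply: integrable_sum => // i _; exact: fi.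
rewrite integral_sum//.
under eq_bigr do rewrite integral_row ?Lfun2_integrable//.
have := expectation_fin_num f1; rewrite unlock => /fineK <-.
by rewrite sumEFin -EFinM sumr_const card_ord -[X in _ * X]mulr_natl mulKf.
Qed.

Lemma cond_expectation_sample_mean (u : {set 'I_D}) (f : D.-tuple T -> R) :
  f \in Lfun P0 2%:E ->
  {ae P, forall w,
    cond_expectation P (sigma_inputs (column_point x) u) (sample_mean x f) w =
    n%:R^-1 * \sum_(i < n)
      cond_expectation P0 (sigma_inputs (@coordinate T D) u) f (row_point x i w)}.
Proof.
move=> f2; have fi := Lfun2_integrable f2.
have mcol := input_preimages_measurable measurable_column_point (u := u).
apply: (@is_cond_expectation_ae_eq _ _ _ P _ mcol (sample_mean x f)).
  by apply: (cond_expectation_spec mcol); exact/Lfun2_integrable/sample_mean_Lfun2.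
apply: (@is_cond_expectation_mean _ _ _ P _ mcol _ _ (fun i => f \o row_point x i)
  (fun i => cond_expectation P0 (sigma_inputs (@coordinate T D) u) f \o row_point x i)).
  by move=> i; exact: integrable_row.
move=> i; apply: cond_expectation_row => //; apply: cond_expectation_spec => //.
by apply: input_preimages_measurable => j; exact: measurable_coordinate.
Qed.

(** Both families of effects satisfy the same recursion, whose leading terms
    agree almost surely by [cond_expectation_sample_mean]; only finitely many
    exceptional null sets are merged at each step. *)
Lemma anova_effect_sample_mean (u : {set 'I_D}) (f : D.-tuple T -> R) :
  f \in Lfun P0 2%:E ->
  {ae P, forall w, anova_effect P (column_point x) (sample_mean x f) u w =
    sample_mean x (anova_effect P0 (@coordinate T D) f u) w}.
Proof.
move=> f2; move: {2}_.+1 (ltnSn #|u|) => k.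
elim: k u => // k IH u uk; rewrite !anova_effectE.
have nN0 : n%:R != 0 :> R by rewrite pnatr_eq0 -lt0n.
case: ifPn => [_|u0].
  apply: nearW => w; rewrite /sample_mean /= expectation_sample_mean//.
  by rewrite sumr_const card_ord -[X in _ * X]mulr_natl mulKf.
have IHv (v : {set 'I_D}) : \forall w \near almost_everywhere P, v \proper u ->
    anova_effect P (column_point x) (sample_mean x f) v w =
    sample_mean x (anova_effect P0 (@coordinate T D) f v) w.
  case: (boolP (v \proper u)) => vu; last by apply: nearW => w uv; case/negP: vu.
  by apply: filterS (IH v (leq_trans (proper_card vu) uk)) => w ->.
have IHall := filter_forall (ae_filter_ringOfSetsType P) IHv.
apply: filterS2 (cond_expectation_sample_mean u f2) IHall => w -> IHw.
rewrite (eq_bigr _ IHw) /sample_mean.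
by rewrite -mulr_sumr -mulrBr exchange_big/= -sumrB.
Qed.

End independent_rows.

(** Zero and infinite values of a and b are included because the denominator of
    the mean dimension is a sum of variance components, whose positivity would
    otherwise need the decomposition of the variance. *)
Lemma ediv_scale (R : realType) (r : R) (a b : \bar R) : (0 < r)%R ->
  ((a / r%:E) / (b / r%:E) = a / b)%E.
Proof.
move=> r0; have rN0 : r != 0 by rewrite gt_eqF.
have -> : (b / r%:E)^-1%E = (r%:E * b^-1)%E.
  case: b => [b| |]; rewrite ?inver ?(negbTE rN0).
  - rewrite -EFinM inver mulf_eq0 invr_eq0 (negbTE rN0) orbF.
    case: eqP => _; first by rewrite gt0_muley ?lte_fin.
    by rewrite -EFinM invfM invrK mulrC.
  - by rewrite gt0_mulye ?lte_fin ?invr_gt0// invey mule0.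
  - by rewrite gt0_mulNye ?lte_fin ?invr_gt0// inveNy gt0_muleNy ?lte_fin.
rewrite -muleA; congr (_ * _)%E.
by rewrite muleA inver (negbTE rN0) -EFinM mulVf// mul1e.
Qed.

Theorem mainTheorem2 (R : realType) (D n : nat) (hD : (1 <= D)%N) (hn : (1 <= n)%N)
    (* the law of D independent inputs uniform on [0, 1) *)
    (P0 : probability (D.-tuple (unitI R)) R)
    (indep0 : mutually_independent P0 (@coordinate (unitI R) D))
    (unif0 : forall j : 'I_D, uniform_on_unitI P0 (coordinate j))
    (f : D.-tuple (unitI R) -> R)
    (f_L2 : f \in Lfun P0 2%:E) (f_var : (0 < 'V_P0[f])%E)
    (* the n x D random matrix with entries x i j *)
    (d : measure_display) (Omega : measurableType d) (P : probability Omega R)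
    (x : 'I_n -> 'I_D -> Omega -> unitI R)
    (indep : mutually_independent P (fun ij : 'I_n * 'I_D => x ij.1 ij.2))
    (unif : forall i j, uniform_on_unitI P (x i j)) :
  let input := @coordinate (unitI R) D in
  let column := column_point x in
  let F := sample_mean x f in
  [/\ forall u : {set 'I_D}, {ae P, forall w, anova_effect P column F u w =
        n%:R^-1 * \sum_(i < n) anova_effect P0 input f u (row_point x i w)},
      forall u : {set 'I_D}, (variance_component P column F u =
        variance_component P0 input f u / (n%:R)%:E)%E,
      forall u : {set 'I_D}, normalized_lower_sobol P column F u =
        normalized_lower_sobol P0 input f u,
      forall u : {set 'I_D}, normalized_upper_sobol P column F u =
        normalized_upper_sobol P0 input f u
    & mean_dimension P column F = mean_dimension P0 input f].
Proof.
move=> input column F.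
have mx i j : measurable_fun setT (x i j) by case: (unif i j).
(* Measurable sets of the unit interval are traces of Borel sets, on which
   both laws are the uniform one. *)
have law i j B : measurable B -> P (x i j @^-1` B) = P0 (input j @^-1` B).
  move=> [B' mB' <-]; rewrite setTI.
  by have [_ ->] := unif i j; last exact: mB'; have [_ ->] := unif0 j.
have effectE (u : {set 'I_D}) := anova_effect_sample_mean indep0 mx indep law hn u f_L2.
have effect2 u : anova_effect P0 input f u \in Lfun P0 2%:E.
  by apply: anova_effect_Lfun2 => // j; exact: measurable_coordinate.
have F2 : F \in Lfun P 2%:E := sample_mean_Lfun2 indep0 mx indep law f_L2.
have componentE (u : {set 'I_D}) : (variance_component P column F u =
    variance_component P0 input f u / n%:R%:E)%E.
  rewrite /variance_component -(variance_sample_mean indep0 mx indep law hn)//.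
  apply: variance_ae_eq => //.
    by apply: anova_effect_Lfun2 => // j; exact: measurable_column_point.
  exact: (sample_mean_Lfun2 indep0 mx indep law).
have VF : ('V_P[F] = 'V_P0[f] / n%:R%:E)%E := variance_sample_mean indep0 mx indep law hn f_L2.
have n0 : (0 : R) < n%:R by rewrite ltr0n.
have component_ge0 u : (0 <= variance_component P0 input f u)%E by exact: variance_ge0.
have sumE (Q : pred {set 'I_D}) (c : {set 'I_D} -> R) : (forall u, 0 <= c u) ->
    (\sum_(u | Q u) (c u)%:E * variance_component P column F u =
     (\sum_(u | Q u) (c u)%:E * variance_component P0 input f u) / n%:R%:E)%E.
  move=> c0; rewrite ge0_sume_distrl; last first.
    by move=> u _; rewrite mule_ge0// lee_fin.
  by apply: eq_bigr => u _; rewrite componentE muleA.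
have sum1E (Q : pred {set 'I_D}) :
    (\sum_(u | Q u) variance_component P column F u =
     (\sum_(u | Q u) variance_component P0 input f u) / n%:R%:E)%E.
  have := sumE Q (fun=> 1) (fun=> ler01).
  by under eq_bigr do rewrite mul1e; under [in RHS]eq_bigr do rewrite mul1e.
split=> [//|//|u|u|].
- by rewrite /normalized_lower_sobol VF /lower_sobol sum1E ediv_scale.
- by rewrite /normalized_upper_sobol VF /upper_sobol sum1E ediv_scale.
- by rewrite /mean_dimension sum1E sumE ?ediv_scale// => u.
Qed.
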